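(* For any real coefficients $\hat\alpha$, $\gamma$, $\hat\Omega$, not all zero, the slowly varying (continuum) approximation $$\hat\alpha\,\phi''(x)-\gamma\,\phi'(x)\left[(\phi'(x))^2+3\phi(x)\phi''(x)\right]=\hat\Omega\,\phi(x),\qquad x\in\mathbb{R},$$ of the stationary generalized discrete nonlinear Schrödinger equation $$\alpha(\phi_{n+1}+\phi_{n-1})+\gamma\left(3\phi_n^2(\phi_{n+1}-\phi_{n-1})-\phi_{n+1}^3+\phi_{n-1}^3\right)=\Omega\phi_n,\qquad n\in\mathbb{Z},$$ admits no localized solutions; that is, there is no real-valued, not identically zero $\phi\in C^2(\mathbb{R})$ satisfying the differential equation with $\phi(x)\to0$ and $\phi'(x)\to0$ as $|x|\to\infty$.
   Context: The slowly varying approximation of the lattice equation is obtained by setting $\phi_n=\phi(x_n)$ with $x_n=hn$, expanding $\phi_{n\pm1}=\phi(x_n)\pm h\phi'(x_n)+\frac12h^2\phi''(x_n)+\mathcal{O}(h^3)$, applying the scaling $\alpha=2h\hat\alpha$, $\Omega-2\alpha=2h^3\hat\Omega$, and keeping the leading order as $h\to0$; this yields the differential equation displayed in the claim. ''Localized'' means a nontrivial classical solution decaying to zero with its derivative at infinity. *)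

(* Defs.v *)
(* Stdlib reals with Coquelicot. *)
From Stdlib Require Import Reals.
From Coquelicot Require Import Coquelicot.
Open Scope R_scope.

(* [ex_derive_n phi 2 x] only says that [Derive phi] is differentiable at [x],
   so existence is also required at order 1; order 0 is trivially true. *)
Definition is_C2 (phi : R -> R) : Prop :=
  (forall (k : nat) (x : R), (k <= 2)%nat -> ex_derive_n phi k x) /\
  (forall x : R, continuous (Derive_n phi 2) x).

(* Under the scaling alpha = 2 h ahat, Omega - 2 alpha = 2 h^3 Ohat, this is the
   leading order as h -> 0, with phi_n = phi (h n), of
     alpha (phi_{n+1} + phi_{n-1})
       + gamma (3 phi_n^2 (phi_{n+1} - phi_{n-1}) - phi_{n+1}^3 + phi_{n-1}^3)
     = Omega phi_n. *)
Definition continuum_equation (ahat gamma Ohat : R) (phi : R -> R) : Prop :=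
  forall x : R,
    ahat * Derive_n phi 2 x
      - gamma * Derive phi x
          * ((Derive phi x) ^ 2 + 3 * phi x * Derive_n phi 2 x)
    = Ohat * phi x.

Definition decays (f : R -> R) : Prop :=
  is_lim f m_infty (Finite 0) /\ is_lim f p_infty (Finite 0).

Definition localized_solution (ahat gamma Ohat : R) (phi : R -> R) : Prop :=
  is_C2 phi /\ continuum_equation ahat gamma Ohat phi /\
  (exists x : R, phi x <> 0) /\ decays phi /\ decays (Derive phi).

(* Main.v *)
(* Multiplying the equation by phi' makes it exact, because
   (phi phi'^3)' = phi'^2 (phi'^2 + 3 phi phi''); decay at infinity then gives
     ahat phi'^2 - 2 gamma phi phi'^3 = Ohat phi^2.
   At a global maximum of phi^2 this forces Ohat = 0.  Hence everywhere phi' = 0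
   or 2 gamma phi phi' = ahat, so the continuous function 2 gamma phi phi' only
   takes the values 0 and ahat; as it tends to 0, it vanishes identically.
   So phi phi' = 0 (if gamma = 0, then ahat <> 0 and already phi' = 0), and
   phi^2 is constant, hence zero. *)
Require Import Defs.
From Stdlib Require Import Reals Lra.
From Coquelicot Require Import Coquelicot.
Open Scope R_scope.

Lemma is_lim_p_infty_Rabs_lt (f : R -> R) (l eps : R) :
  is_lim f p_infty l -> 0 < eps -> exists M, forall x, M < x -> Rabs (f x - l) < eps.
Proof.
intros Hf He; apply is_lim_spec in Hf; exact (Hf (mkposreal eps He)).
Qed.

Lemma is_lim_m_infty_Rabs_lt (f : R -> R) (l eps : R) :
  is_lim f m_infty l -> 0 < eps -> exists M, forall x, x < M -> Rabs (f x - l) < eps.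
Proof.
intros Hf He; apply is_lim_spec in Hf; exact (Hf (mkposreal eps He)).
Qed.

(** To the right of [x], [f] agrees with the constant [f x], and limits are unique. This fixes the
    integration constants below. *)
Lemma is_derive_0_is_lim (f : R -> R) (l : R) :
  (forall x, is_derive f x 0) -> is_lim f p_infty l -> forall x, f x = l.
Proof.
intros Hd Hl x.
assert (Hc : is_lim (fun _ => f x) p_infty l).
{ apply is_lim_ext_loc with f; [|exact Hl].
  exists x; intros y Hy; symmetry.
  apply (eq_is_derive f); [intros t _; apply Hd | exact Hy]. }
apply is_lim_unique in Hc; rewrite Lim_const in Hc; now injection Hc.
Qed.

Lemma decays_mult (f g : R -> R) :
  decays f -> decays g -> decays (fun x => f x * g x).
Proof.
intros [fm fp] [gm gp]; split;
  rewrite <- (Rmult_0_l 0).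
- now apply (is_lim_mult f g m_infty 0 0).
- now apply (is_lim_mult f g p_infty 0 0).
Qed.

Lemma decays_scal (f : R -> R) (c : R) : decays f -> decays (fun x => c * f x).
Proof.
intros [fm fp]; split; rewrite <- (Rmult_0_r c).
- exact (is_lim_scal_l f c m_infty 0 fm).
- exact (is_lim_scal_l f c p_infty 0 fp).
Qed.

Lemma decays_minus (f g : R -> R) :
  decays f -> decays g -> decays (fun x => f x - g x).
Proof.
intros [fm fp] [gm gp]; split; rewrite <- (Rminus_0_r 0).
- now apply is_lim_minus'.
- now apply is_lim_minus'.
Qed.

(** Decay with tolerance [f x0] keeps [f] below [f x0] outside a compact interval. Widened to
    contain [x0], that interval has a maximum that is global. *)
Lemma decays_has_max (f : R -> R) (x0 : R) :
  continuity f -> decays f -> 0 < f x0 -> exists m, forall x, f x <= f m.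
Proof.
intros Hc [Hm Hp] H0.
destruct (is_lim_m_infty_Rabs_lt f 0 (f x0) Hm H0) as [A HA].
destruct (is_lim_p_infty_Rabs_lt f 0 (f x0) Hp H0) as [B HB].
pose (a := Rmin A x0); pose (b := Rmax B x0).
assert (Ha : a <= x0) by apply Rmin_r.
assert (Hb : x0 <= b) by apply Rmax_r.
destruct (continuity_ab_maj f a b) as [m [Hmax _]]; [lra | intros; apply Hc |].
exists m; intros x.
assert (H0m : f x0 <= f m) by (apply Hmax; lra).
destruct (Rlt_le_dec x a) as [Hx|Hx].
- assert (HAx := HA x ltac:(pose proof (Rmin_l A x0); unfold a in *; lra)).
  apply Rabs_def2 in HAx; lra.
- destruct (Rlt_le_dec b x) as [Hx'|Hx'].
  + assert (HBx := HB x ltac:(pose proof (Rmax_l B x0); unfold b in *; lra)).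
    apply Rabs_def2 in HBx; lra.
  + apply Hmax; lra.
Qed.

Lemma is_derive_at_max (f : R -> R) (m l : R) :
  is_derive f m l -> (forall x, f x <= f m) -> l = 0.
Proof.
intros Hd Hmax.
assert (pr : derivable_pt f m) by (exists l; now apply is_derive_Reals).
rewrite <- (is_derive_unique f m l Hd), <- (Derive_Reals f m pr).
apply (deriv_maximum f (m - 1) (m + 1)); [lra | lra | intros; apply Hmax].
Qed.

(** A jump from [c] to 0 would, by the intermediate value theorem, pass through [c / 2], which is
    neither value. *)
Lemma two_valued_decays (q : R -> R) (c : R) :
  continuity q -> decays q -> (forall x, q x = 0 \/ q x = c) -> forall x, q x = 0.
Proof.
intros Hc [_ Hp] Hv x.
destruct (Req_dec c 0) as [->|Hc0]; [now destruct (Hv x)|].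
destruct (Hv x) as [Hx|Hx]; [exact Hx|exfalso].
(* The tolerance [Rabs c] rules out the value [c] beyond [M], so [q] is 0 there. *)
destruct (is_lim_p_infty_Rabs_lt q 0 (Rabs c) Hp (Rabs_pos_lt c Hc0)) as [M HM].
assert (Hy := HM (M + 1) ltac:(lra)).
assert (Hy0 : q (M + 1) = 0).
{ destruct (Hv (M + 1)) as [E|E]; [exact E|].
  rewrite E, Rminus_0_r in Hy; lra. }
destruct (IVT_gen q x (M + 1) (c / 2) Hc) as [z [_ Hz]].
- rewrite Hx, Hy0; unfold Rmin, Rmax; destruct (Rle_dec c 0); lra.
- destruct (Hv z); lra.
Qed.

Theorem proposition1 (ahat gamma Ohat : R)
  (not_all_zero : ~ (ahat = 0 /\ gamma = 0 /\ Ohat = 0)) :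
  ~ exists phi : R -> R, localized_solution ahat gamma Ohat phi.
Proof.
intros [phi [[Hex _] [Heq [[x0 Hx0] [Dphi Dp]]]]].
assert (d1 : forall x, is_derive phi x (Derive phi x))
  by (intros x; apply Derive_correct, (Hex 1%nat x); auto).
assert (d2 : forall x, is_derive (Derive phi) x (Derive_n phi 2 x))
  by (intros x; apply Derive_correct, (Hex 2%nat x); auto).
unfold continuum_equation in Heq.
(* From here on [p] and [s] are opaque functions, tied to [phi] only by [d1] and [d2]. *)
set (p := Derive phi) in *; set (s := Derive_n phi 2) in *; clearbody p s.
assert (cphi : continuity phi).
{ intros x; apply continuity_pt_filterlim, (ex_derive_continuous phi).
  now exists (p x). }
assert (cp : continuity p).
{ intros x; apply continuity_pt_filterlim, (ex_derive_continuous p).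
  now exists (s x). }
assert (Dsq : decays (fun x => phi x * phi x)) by now apply decays_mult.
assert (dsq : forall x, is_derive (fun x => phi x * phi x) x (2 * (phi x * p x))).
{ intros x; evar_last.
  - apply (is_derive_mult phi phi); [apply d1 | apply d1 | intros; apply Rmult_comm].
  - unfold plus, mult; simpl; ring. }
assert (E : forall x,
  ahat * (p x * p x) - 2 * gamma * (phi x * p x * (p x * p x))
    - Ohat * (phi x * phi x) = 0).
{ apply (is_derive_0_is_lim (fun x =>
    ahat * (p x * p x) - 2 * gamma * (phi x * p x * (p x * p x))
      - Ohat * (phi x * phi x))).
  - intros x; specialize (Heq x).
    (* The eta-expanded forms match the terms produced by [auto_derive]. *)
    assert (e1 : Derive (fun t => phi t) x = p x) by apply is_derive_unique, d1.
    assert (e2 : Derive (fun t => p t) x = s x) by apply is_derive_unique, d2.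
    assert (h1 : ex_derive (fun t => phi t) x) by now exists (p x).
    assert (h2 : ex_derive (fun t => p t) x) by now exists (s x).
    auto_derive; [tauto|].
    rewrite e1, e2.
    (* The derivative is [2 * p x] times the difference of the two sides of the equation. *)
    transitivity (2 * p x * (ahat * s x
      - gamma * p x * (p x ^ 2 + 3 * phi x * s x) - Ohat * phi x)); [ring|].
    rewrite Heq; ring.
  - apply decays_minus; [apply decays_minus|]; apply decays_scal;
      repeat apply decays_mult; assumption. }
assert (Hpos : 0 < phi x0 * phi x0) by now apply Rsqr_pos_lt.
assert (HO : Ohat = 0).
{ destruct (decays_has_max (fun x => phi x * phi x) x0) as [m Hm];
    [now apply continuity_mult | exact Dsq | exact Hpos |].
  assert (Hd := is_derive_at_max _ _ _ (dsq m) Hm).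
  specialize (Hm x0); cbv beta in Hm; specialize (E m).
  (* The maximum is at least [phi x0 * phi x0 > 0]; hence [p m = 0], and [E] at [m] reduces to
     [Ohat * (phi m * phi m) = 0]. *)
  assert (Hphi : phi m <> 0) by (intros Z; rewrite Z in Hm; lra).
  assert (Hp : p m = 0).
  { destruct (Rmult_integral (phi m) (p m)); [lra | contradiction | assumption]. }
  rewrite Hp in E.
  destruct (Rmult_integral Ohat (phi m * phi m)); [lra | assumption | lra]. }
subst Ohat.
assert (Hpq : forall x, p x = 0 \/ 2 * gamma * (phi x * p x) = ahat).
{ intros x; specialize (E x).
  destruct (Req_dec (p x) 0) as [Z|Z]; [now left|right].
  (* With [Ohat = 0], [E] factors as [p x * p x] times [ahat - 2 * gamma * (phi x * p x)]. *)
  apply Rminus_diag_uniq_sym, Rmult_eq_reg_l with (p x * p x);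
    [lra | now apply Rmult_integral_contrapositive]. }
assert (Hq : forall x, 2 * gamma * (phi x * p x) = 0).
{ apply (two_valued_decays (fun x => 2 * gamma * (phi x * p x)) ahat).
  - apply (continuity_scal (fun x => phi x * p x)), (continuity_mult phi p);
      assumption.
  - now apply decays_scal, decays_mult.
  - intros x; destruct (Hpq x) as [->|]; [left; ring | now right]. }
assert (Hphip : forall x, phi x * p x = 0).
{ intros x; destruct (Req_dec gamma 0) as [Z|Z].
  - destruct (Hpq x) as [->|Ha]; [ring|].
    (* Here [gamma = 0] turns [Ha] into [ahat = 0], so all three coefficients vanish. *)
    exfalso; apply not_all_zero; rewrite <- Ha, Z; repeat split; ring.
  - apply Rmult_eq_reg_l with (2 * gamma); [rewrite (Hq x); ring | lra]. }
assert (Hsq : phi x0 * phi x0 = 0).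
{ apply (is_derive_0_is_lim (fun x => phi x * phi x)); [|apply Dsq].
  intros x; evar_last; [apply dsq | rewrite Hphip; ring]. }
lra.
Qed.
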